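(* Let $\tilde\Lambda^0,\tilde{\boldsymbol\Lambda}^1,\tilde{\boldsymbol\Lambda}^2,\tilde\Lambda^3$ be the tensor-product spline bases on $[0,1]^3$ (clamped in $\xi_1$, periodic in $\xi_2,\xi_3$), and let $$\mathsf{G}=\begin{pmatrix} D_1 \\ D_2 \\ D_3 \end{pmatrix},\qquad \mathsf{C}=\begin{pmatrix} 0&-D_3&D_2 \\ D_3&0&-D_1 \\ -D_2&D_1&0 \end{pmatrix},\qquad \mathsf{D}=\begin{pmatrix} D_1&D_2&D_3 \end{pmatrix}$$ be the associated derivative matrices, with $D_1=D_\star\otimes\mathbb{I}\otimes\mathbb{I}$, $D_2=\mathbb{I}\otimes D\otimes\mathbb{I}$, $D_3=\mathbb{I}\otimes\mathbb{I}\otimes D$ (all as defined in the context). Then the spline bases form a discrete de Rham sequence with these derivative matrices, i.e. $\mathsf{C}\mathsf{G}=0$, $\mathsf{D}\mathsf{C}=0$ and $$\nabla_{\boldsymbol\xi}\tilde\Lambda^0=\tilde{\boldsymbol\Lambda}^1\mathsf{G},\qquad \nabla_{\boldsymbol\xi}\times\tilde{\boldsymbol\Lambda}^1=\tilde{\boldsymbol\Lambda}^2\mathsf{C},\qquad \nabla_{\boldsymbol\xi}\cdot\tilde{\boldsymbol\Lambda}^2=\tilde\Lambda^3\mathsf{D}.$$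
   Context: Spline degree $p\ge1$; numbers of cells $n_1,n_2,n_3$ in the three directions (sizes of $D$ and $\mathbb{I}$ match the respective direction). For a non-decreasing knot sequence $(t_j)$ define B-splines by $S^0_j=\chi_{[t_j,t_{j+1})}$ (the last nonempty interval being closed; zero if $t_j=t_{j+1}$) and $$S^p_j(\xi)=\frac{\xi-t_j}{t_{j+p}-t_j}S^{p-1}_j(\xi)+\frac{t_{j+p+1}-\xi}{t_{j+p+1}-t_{j+1}}S^{p-1}_{j+1}(\xi),$$ where terms with zero denominator are dropped. Clamped splines (direction $\xi_1$): with $n=n_1$, $\Delta\xi=1/n$, take $t_{1-p}=\dots=t_1=0$, $t_j=(j-1)\Delta\xi$ for $1\le j\le n+1$, $t_{n+1}=\dots=t_{n+p+1}=1$. Set $\mathcal{S}^p_\star=(S^p_{1-p},\dots,S^p_n)$ and, on the same knots, $\mathcal{S}^{p-1}_\star=(S^{p-1}_{1-p},\dots,S^{p-1}_n)$, whose first entry $S^{p-1}_{1-p}$ is identically zero (row vectors of length $n+p$). The matrix $D_\star\in\mathbb{R}^{(n+p)\times(n+p)}$, with rows and columns indexed by $1-p,\dots,n$, has entries $(D_\star)_{j,j}=\frac{p}{t_{j+p}-t_j}$ for $2-p\le j\le n$, $(D_\star)_{j+1,j}=-\frac{p}{t_{j+p+1}-t_{j+1}}$ for $1-p\le j\le n-1$, and zeros elsewhere (in particular the first row is zero). It represents differentiation: $\frac{d}{d\xi}\mathcal{S}^p_\star=\mathcal{S}^{p-1}_\star D_\star$. Periodic splines (directions $\xi_2,\xi_3$):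 with $n$ cells, $\Delta\xi=1/n$, $\mathcal{S}^p=(S^p_1,\dots,S^p_n)$ and $\mathcal{S}^{p-1}=(S^{p-1}_1,\dots,S^{p-1}_n)$ are the 1-periodisations of the B-splines on the uniform knots $t_j=(j-1)\Delta\xi$, $j\in\mathbb{Z}$. The matrix $D\in\mathbb{R}^{n\times n}$ represents $\frac{d}{d\xi}\mathcal{S}^p=\mathcal{S}^{p-1}D$; it is $\frac1{\Delta\xi}$ times the circulant matrix with $1$ on the diagonal, $-1$ on the first subdiagonal and $-1$ in the upper right corner. Derivatives of degree-one splines are understood away from the knots. The bases are (row vectors; $\otimes$ is the Kronecker product, factors depending on $\xi_1,\xi_2,\xi_3$ respectively): $\tilde\Lambda^0=\mathcal{S}^p_\star\otimes\mathcal{S}^p\otimes\mathcal{S}^p$, $\tilde\Lambda^3=\mathcal{S}^{p-1}_\star\otimes\mathcal{S}^{p-1}\otimes\mathcal{S}^{p-1}$, $\tilde{\boldsymbol\Lambda}^1=\operatorname{diag}(\tilde\Lambda^{1,1},\tilde\Lambda^{1,2},\tilde\Lambda^{1,3})$, $\tilde{\boldsymbol\Lambda}^2=\operatorname{diag}(\tilde\Lambda^{2,1},\tilde\Lambda^{2,2},\tilde\Lambda^{2,3})$ (block-diagonal, three rows) with $\tilde\Lambda^{1,1}=\mathcal{S}^{p-1}_\star\otimes\mathcal{S}^p\otimes\mathcal{S}^p$, $\tilde\Lambda^{1,2}=\mathcal{S}^p_\star\otimes\mathcal{S}^{p-1}\otimes\mathcal{S}^p$, $\tilde\Lambda^{1,3}=\mathcal{S}^p_\star\otimes\mathcal{S}^p\otimes\mathcal{S}^{p-1}$,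 $\tilde\Lambda^{2,1}=\mathcal{S}^p_\star\otimes\mathcal{S}^{p-1}\otimes\mathcal{S}^{p-1}$, $\tilde\Lambda^{2,2}=\mathcal{S}^{p-1}_\star\otimes\mathcal{S}^p\otimes\mathcal{S}^{p-1}$, $\tilde\Lambda^{2,3}=\mathcal{S}^{p-1}_\star\otimes\mathcal{S}^{p-1}\otimes\mathcal{S}^p$. The operators $\nabla_{\boldsymbol\xi}$, $\nabla_{\boldsymbol\xi}\times$, $\nabla_{\boldsymbol\xi}\cdot$ act on each column (basis function). *)

(* Defs.v *)
From mathcomp Require Import all_boot all_order all_algebra.
From mathcomp.real_closed Require Import mxtens.
From mathcomp Require Import all_classical all_reals all_analysis.

Set Implicit Arguments.
Unset Strict Implicit.
Unset Printing Implicit Defensive.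

Import Order.TTheory GRing.Theory Num.Theory.
Import numFieldNormedType.Exports.
Local Open Scope classical_set_scope.
Local Open Scope ring_scope.

(* A knot sequence is indexed by all integers. A finite clamped sequence is
   extended by constants at both ends, so that "the last nonempty interval" is
   the last one of the finite sequence. A knot sequence that is unbounded above
   has no last interval. *)
Definition last_interval (R : realType) (t : int -> R) (j : int) : Prop :=
  t j < t (j + 1) /\ forall k : int, j < k -> t k <= t (j + 1).

Definition knot_interval (R : realType) (t : int -> R) (j : int) : set R :=
  [set x | t j <= x < t (j + 1) \/ last_interval t j /\ x = t (j + 1)].

(* Since x / 0 = 0 in MathComp, the terms with zero denominator vanish. *)
Fixpoint bspline (R : realType) (t : int -> R) (p : nat) (j : int) (x : R) : R :=
  if p is q.+1 then
    (x - t j) / (t (j + p%:Z) - t j) * bspline t q j x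
    + (t (j + p%:Z + 1) - x) / (t (j + p%:Z + 1) - t (j + 1))
        * bspline t q (j + 1) x
  else \1_(knot_interval t j) x.

Definition clamped_knot (R : realType) (n : nat) (j : int) : R :=
  if j <= 1 then 0 else if j <= n%:Z + 1 then (j - 1)%:~R / n%:R else 1.

Definition uniform_knot (R : realType) (n : nat) (j : int) : R :=
  (j - 1)%:~R / n%:R.

(* The row (S^q_{1-p}, ..., S^q_n): the column k : 'I_(n + p) carries the
   index j = k + 1 - p. It is used for q = p and q = p - 1. *)
Definition clamped_index (p k : nat) : int := k%:Z + 1 - p%:Z.

Definition clamped_basis (R : realType) (n p q : nat) (x : R) : 'rV[R]_(n + p) :=
  \row_(k < n + p) bspline (clamped_knot R n) q (clamped_index p k) x.

(* The row (S^q_1, ..., S^q_n) of 1-periodised B-splines; at each x only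
   finitely many terms of the sum are nonzero. *)
Definition periodic_basis (R : realType) (n q : nat) (x : R) : 'rV[R]_n :=
  \row_(k < n) \sum_(m \in [set: int])
     bspline (uniform_knot R n) q (k%:Z + 1) (x + m%:~R).

Definition clamped_D (R : realType) (n p : nat) : 'M[R]_(n + p) :=
  \matrix_(i < n + p, k < n + p)
    let t := clamped_knot R n in
    let j := clamped_index p k in
    if (i == k) && (0 < k)%N then p%:R / (t (j + p%:Z) - t j)
    else if i == k.+1 :> nat
      then - (p%:R / (t (j + p%:Z + 1) - t (j + 1)))
    else 0.

(* For n = 1 the diagonal and the upper right corner are the same entry, whose
   contributions add up: the matrix is then 0. *)
Definition periodic_D (R : realType) (n : nat) : 'M[R]_n :=
  \matrix_(i < n, k < n)
    (n%:R * ((i == k)%:R - (i == (k.+1 %% n)%N :> nat)%:R)).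

Definition row3 (R : Type) (m n1 n2 n3 : nat)
    (A : 'M[R]_(m, n1)) (B : 'M[R]_(m, n2)) (C : 'M[R]_(m, n3)) :
    'M[R]_(m, n1 + n2 + n3) :=
  row_mx (row_mx A B) C.

Definition col3 (R : Type) (m1 m2 m3 n : nat)
    (A : 'M[R]_(m1, n)) (B : 'M[R]_(m2, n)) (C : 'M[R]_(m3, n)) :
    'M[R]_(m1 + m2 + m3, n) :=
  col_mx (col_mx A B) C.

Definition dimN (p n1 n2 n3 : nat) : nat := ((n1 + p) * n2 * n3)%N.

Definition mxD1 (R : realType) (p n1 n2 n3 : nat) : 'M[R]_(dimN p n1 n2 n3) :=
  clamped_D R n1 p *t (1%:M : 'M[R]_n2) *t (1%:M : 'M[R]_n3).

Definition mxD2 (R : realType) (p n1 n2 n3 : nat) : 'M[R]_(dimN p n1 n2 n3) :=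
  (1%:M : 'M[R]_(n1 + p)) *t periodic_D R n2 *t (1%:M : 'M[R]_n3).

Definition mxD3 (R : realType) (p n1 n2 n3 : nat) : 'M[R]_(dimN p n1 n2 n3) :=
  (1%:M : 'M[R]_(n1 + p)) *t (1%:M : 'M[R]_n2) *t periodic_D R n3.

Definition gradM (R : realType) (p n1 n2 n3 : nat) :=
  col3 (mxD1 R p n1 n2 n3) (mxD2 R p n1 n2 n3) (mxD3 R p n1 n2 n3).

Definition curlM (R : realType) (p n1 n2 n3 : nat) :=
  let D1 := mxD1 R p n1 n2 n3 in
  let D2 := mxD2 R p n1 n2 n3 in
  let D3 := mxD3 R p n1 n2 n3 in
  col3 (row3    0   (- D3)   D2  )
       (row3    D3     0   (- D1))
       (row3 (- D2)    D1     0  ).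

Definition divM (R : realType) (p n1 n2 n3 : nat) :=
  row3 (mxD1 R p n1 n2 n3) (mxD2 R p n1 n2 n3) (mxD3 R p n1 n2 n3).

(* S^q1_* (x) S^q2 (x) S^q3; the coordinates xi_1, xi_2, xi_3 are numbered
   0, 1, 2. *)
Definition tens_basis (R : realType) (p n1 n2 n3 q1 q2 q3 : nat)
    (xi : 'rV[R]_3) : 'rV[R]_(dimN p n1 n2 n3) :=
  clamped_basis n1 p q1 (xi 0 0)
    *t periodic_basis n2 q2 (xi 0 1) *t periodic_basis n3 q3 (xi 0 2).

Definition Lambda0 (R : realType) (p n1 n2 n3 : nat) (xi : 'rV[R]_3) :
    'rV[R]_(dimN p n1 n2 n3) :=
  tens_basis p n1 n2 n3 p p p xi.

Definition Lambda1 (R : realType) (p n1 n2 n3 : nat) (xi : 'rV[R]_3) :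
    'M[R]_(3, dimN p n1 n2 n3 + dimN p n1 n2 n3 + dimN p n1 n2 n3) :=
  col3 (row3 (tens_basis p n1 n2 n3 p.-1 p p xi) 0 0)
       (row3 0 (tens_basis p n1 n2 n3 p p.-1 p xi) 0)
       (row3 0 0 (tens_basis p n1 n2 n3 p p p.-1 xi)).

Definition Lambda2 (R : realType) (p n1 n2 n3 : nat) (xi : 'rV[R]_3) :
    'M[R]_(3, dimN p n1 n2 n3 + dimN p n1 n2 n3 + dimN p n1 n2 n3) :=
  col3 (row3 (tens_basis p n1 n2 n3 p p.-1 p.-1 xi) 0 0)
       (row3 0 (tens_basis p n1 n2 n3 p.-1 p p.-1 xi) 0)
       (row3 0 0 (tens_basis p n1 n2 n3 p.-1 p.-1 p xi)).

Definition Lambda3 (R : realType) (p n1 n2 n3 : nat) (xi : 'rV[R]_3) :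
    'rV[R]_(dimN p n1 n2 n3) :=
  tens_basis p n1 n2 n3 p.-1 p.-1 p.-1 xi.

(* [0,1] x R x R, on which functions that are 1-periodic in xi_2 and xi_3 stand
   for functions on [0,1] x (R/Z) x (R/Z). *)
Definition xi_dom (R : realType) : set 'rV[R]_3 := [set xi | 0 <= xi 0 0 <= 1].

(* Partial derivatives are taken within xi_dom: they are one-sided in xi_1 on the
   faces xi_1 = 0 and xi_1 = 1, and two-sided everywhere else. *)
Definition dquot (R : realType) (i : 'I_3) (f : 'rV[R]_3 -> R)
    (xi : 'rV[R]_3) (h : R) : R :=
  h^-1 * (f (xi + h *: delta_mx 0 i) - f xi).

Definition increments (R : realType) (i : 'I_3) (xi : 'rV[R]_3) :
    set_system R :=
  within [set h | xi_dom (xi + h *: delta_mx 0 i)] 0^'.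

Definition pderivable (R : realType) (i : 'I_3) (f : 'rV[R]_3 -> R)
    (xi : 'rV[R]_3) : Prop :=
  cvg (dquot i f xi h @[h --> increments i xi]).

Definition pderiv (R : realType) (i : 'I_3) (f : 'rV[R]_3 -> R)
    (xi : 'rV[R]_3) : R :=
  lim (dquot i f xi h @[h --> increments i xi]).

(* The differential operators act on each column. *)
Definition grad (R : realType) (N : nat) (A : 'rV[R]_3 -> 'rV[R]_N)
    (xi : 'rV[R]_3) : 'M[R]_(3, N) :=
  \matrix_(i < 3, j < N) pderiv i (fun y => A y 0 j) xi.

(* Row i is d_{i+1} A_{i+2} - d_{i+2} A_{i+1}, with indices modulo 3. *)
Definition curl (R : realType) (N : nat) (A : 'rV[R]_3 -> 'M[R]_(3, N))
    (xi : 'rV[R]_3) : 'M[R]_(3, N) :=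
  \matrix_(i < 3, j < N)
    (pderiv (i + 1) (fun y => A y (i + 2) j) xi
     - pderiv (i + 2) (fun y => A y (i + 1) j) xi).

Definition divergence (R : realType) (N : nat) (A : 'rV[R]_3 -> 'M[R]_(3, N))
    (xi : 'rV[R]_3) : 'rV[R]_N :=
  \row_(j < N) \sum_(i < 3) pderiv i (fun y => A y i j) xi.

(* The partial derivatives that enter the respective operator exist. *)
Definition has_grad (R : realType) (N : nat) (A : 'rV[R]_3 -> 'rV[R]_N)
    (xi : 'rV[R]_3) : Prop :=
  forall (i : 'I_3) (j : 'I_N), pderivable i (fun y => A y 0 j) xi.

Definition has_curl (R : realType) (N : nat) (A : 'rV[R]_3 -> 'M[R]_(3, N))
    (xi : 'rV[R]_3) : Prop :=
  forall (i k : 'I_3) (j : 'I_N), i != k -> pderivable i (fun y => A y k j) xi.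

Definition has_divergence (R : realType) (N : nat)
    (A : 'rV[R]_3 -> 'M[R]_(3, N)) (xi : 'rV[R]_3) : Prop :=
  forall (i : 'I_3) (j : 'I_N), pderivable i (fun y => A y i j) xi.

Definition off_knots (R : realType) (n1 n2 n3 : nat) (xi : 'rV[R]_3) : Prop :=
  forall j : int, [/\ xi 0 0 != clamped_knot R n1 j,
    xi 0 1 != uniform_knot R n2 j & xi 0 2 != uniform_knot R n3 j].

(* Main.v *)
Require Import Defs.
From mathcomp Require Import all_boot all_order all_algebra.
From mathcomp Require Import all_classical all_reals all_analysis.
From mathcomp.real_closed Require Import mxtens.
From mathcomp Require Import ring lra zify.

Set Implicit Arguments.
Unset Strict Implicit.
Unset Printing Implicit Defensive.

Import Order.TTheory GRing.Theory Num.Theory.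
Import numFieldNormedType.Exports.
Local Open Scope classical_set_scope.
Local Open Scope ring_scope.

(** Both matrix identities hold because the three factors of the Kronecker
products act on different indices, so D1, D2 and D3 commute.

For the differential identities everything reduces to one variable. On a cell
between two knots the B-splines of all degrees coincide with polynomials
[bpiece], which satisfy the same recursion, started from a Kronecker delta
instead of an indicator function. The derivative formula of B-splines is then
an algebraic identity between polynomials, [deriv_bpiece], valid for every
nondecreasing knot sequence. It passes to the B-splines at once inside a cell
and at the end points of the domain, where the derivative is one-sided and
only one cell matters. At a simple knot two pieces meet; by [bpiece_knot] they
agree there in every degree at least 1, hence, the derivative having one
degree less, the one-sided derivatives agree from degree 2 on. This gives
[bspline_deriv], which needs points off the knots only in degree 1.

In the clamped direction the columns of the derivative matrix are the two
coefficients of this formula; the two lower-degree B-splines at the ends, all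
of whose knots coincide, drop out ([clamped_deriv]). In the periodic
directions the sum over integer translates is locally a finite sum, and the
upper right corner of the circulant matrix expresses that the translates of
the B-spline with index n + 1 are those of the B-spline with index 1
([periodic_deriv]).

A partial derivative of a tensor-product basis function differentiates a
single factor. On rows this reads: the i-th partial derivative of the tensor
basis that has degree p in direction i is the basis with that degree lowered,
times D_i ([tens_pderiv1] to [tens_pderiv3]). Gradient, curl and divergence of
the block-diagonal bases then follow block by block. *)

(** * Polynomial pieces of B-splines *)

Section Pieces.
Variables (R : realType) (t : int -> R).

(** The polynomial that the B-spline of degree p and index j equals on the
i-th knot interval. *)
Fixpoint bpiece (i : int) (p : nat) (j : int) : {poly R} :=
  if p is q.+1 then
    (t (j + p%:Z) - t j)^-1 *: (('X - (t j)%:P) * bpiece i q j)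
    + (t (j + p%:Z + 1) - t (j + 1))^-1
        *: (((t (j + p%:Z + 1))%:P - 'X) * bpiece i q (j + 1))
  else (j == i)%:R.

Hypothesis t_mono : {homo t : a b / a <= b}.

Lemma knot_interval_inj (i j : int) (x : R) :
  knot_interval t i x -> knot_interval t j x -> i = j.
Proof.
wlog ij : i j / i < j.
  move=> H Hi Hj; case: (ltgtP i j) => // ij; first exact: (H i j).
  by apply/esym/(H j i).
have ij1 : i + 1 <= j by lia.
move=> Hi Hj; exfalso.
have xj : t j <= x by case: Hj => [/andP[]//|[[lt _] ->]]; exact: ltW.
have ltj : t j < t (j + 1).
  by case: Hj => [/andP[]|[[]]//]; exact: le_lt_trans.
case: Hi => [/andP[_ xi]|[[_ last] ?]].
  by have := le_trans (t_mono ij1) xj; rewrite leNgt xi.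
have : t (j + 1) <= t (i + 1) by apply: last; lia.
by rewrite leNgt (le_lt_trans (t_mono ij1)).
Qed.

Lemma bspline_piece (i : int) (x : R) p j :
  knot_interval t i x -> bspline t p j x = (bpiece i p j).[x].
Proof.
move=> Hi; elim: p j => [|p IH] j.
  rewrite /= indicE; case: eqVneq => [->|ji].
    by rewrite mem_set// hornerC.
  rewrite memNset ?horner0// => /(knot_interval_inj Hi) ij.
  by rewrite ij eqxx in ji.
by rewrite /= !IH !hornerE /=; ring.
Qed.

(** A knot span inside an empty span is empty, so with 1 / 0 = 0 the weight of
the inner span absorbs the quotient of the outer one even when the latter is 0
/ 0. This is what makes repeated knots harmless in the derivative formula. *)
Lemma knot_span_divK (a b c d : int) : a <= c -> c <= d -> d <= b ->
  (t d - t c)^-1 * (t b - t a) * (t b - t a)^-1 = (t d - t c)^-1.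
Proof.
move=> ac cd db; have [dc|dc] := eqVneq (t d - t c) 0.
  by rewrite dc invr0 !mul0r.
rewrite mulfK// subr_eq0 gt_eqF//.
have lt : t c < t d.
  by rewrite lt_neqAle t_mono// andbT -subr_eq0 -oppr_eq0 opprB.
by apply: le_lt_trans (t_mono ac) _; exact: lt_le_trans lt (t_mono db).
Qed.

(** Induction on the degree with the product rule. The coefficients of the
outer two lower-degree pieces agree on both sides; those of the middle piece
differ by its weight times the difference of two quotients, each equal to 1 or
killed by the weight ([knot_span_divK]). *)
Lemma deriv_bpiece (i : int) p j :
  (bpiece i p.+1 j)^`() =
  p.+1%:R *: ((t (j + p.+1%:Z) - t j)^-1 *: bpiece i p j
          - (t (j + p.+1%:Z + 1) - t (j + 1))^-1 *: bpiece i p (j + 1)).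
Proof.
elim: p j => [|p IH] j.
  have d0 k : (((k == i)%:R : {poly R})^`()) = 0.
    by rewrite -polyC_natr derivC.
  rewrite /= derivD !derivZ !derivM !derivB derivX !derivC !d0 -!mul_polyC.
  by ring.
have E1 : j + p.+2%:Z = j + p.+1%:Z + 1 by lia.
have E2 : j + 1 + p.+1%:Z = j + p.+1%:Z + 1 by lia.
have Ha := @knot_span_divK j (j + p.+1%:Z + 1) (j + 1) (j + p.+1%:Z + 1).
have Hb := @knot_span_divK (j + 1) (j + p.+1%:Z + 1 + 1)
  (j + 1) (j + p.+1%:Z + 1).
have Hab : (t (j + p.+1%:Z + 1) - t (j + 1))^-1
        * (t (j + p.+1%:Z + 1) - t j) * (t (j + p.+1%:Z + 1) - t j)^-1
   = (t (j + p.+1%:Z + 1) - t (j + 1))^-1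
        * (t (j + p.+1%:Z + 1 + 1) - t (j + 1))
          * (t (j + p.+1%:Z + 1 + 1) - t (j + 1))^-1.
  by rewrite Ha ?Hb//; lia.
move=> {Ha Hb}.
have -> : bpiece i p.+2 j =
    (t (j + p.+2%:Z) - t j)^-1 *: (('X - (t j)%:P) * bpiece i p.+1 j)
    + (t (j + p.+2%:Z + 1) - t (j + 1))^-1
        *: (((t (j + p.+2%:Z + 1))%:P - 'X) * bpiece i p.+1 (j + 1)) by [].
rewrite derivD !derivZ !derivM !derivB derivX !derivC !IH /= !{}E1 !{}E2.
move: (t (j + _ + 1 + 1)) (t (j + _ + 1)) (t (j + _)) (t (j + 1 + 1))
  (t (j + 1)) (t j) (bpiece i p (j + 1 + 1)) (bpiece i p (j + 1)) (bpiece i p j)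
  Hab
  => T5 T4 T3 T2 T1 T0 B2 B1 B0.
move: ((T4 - T0)^-1) ((T5 - T1)^-1) ((T4 - T1)^-1) ((T3 - T0)^-1)
  ((T5 - T2)^-1)
  => a b c d e Hab.
have {}Hab : c%:P * (T4%:P - T0%:P) * a%:P = c%:P * (T5%:P - T1%:P) * b%:P.
  by rewrite -!polyCB -!polyCM Hab.
rewrite -!mul_polyC.
set L := LHS; set Rr := RHS.
(* The two sides differ by the defect in the coefficient of the middle piece. *)
suff -> : L = Rr + p.+1%:R%:P * B1 *
  (c%:P * (T5%:P - T1%:P) * b%:P - c%:P * (T4%:P - T0%:P) * a%:P).
  by rewrite Hab subrr mulr0 addr0.
by rewrite {}/L {}/Rr; ring.
Qed.

(** Continuity of B-splines at a simple knot. In degree 1 only the hat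
function centred at the knot is nonzero there, and it is 1 from both sides;
the recursion then preserves equality of values at the knot. *)
Lemma bpiece_knot (i : int) p j : t (i - 1) < t i -> t i < t (i + 1) ->
  (bpiece i p.+1 j).[t i] = (bpiece (i - 1) p.+1 j).[t i].
Proof.
move=> lt1 lt2; elim: p j => [|p IH] j; last first.
  move: (IH j) (IH (j + 1)).
  rewrite [bpiece i p.+2 j]/= [bpiece (i - 1) p.+2 j]/=.
  by rewrite !(hornerD, hornerZ, hornerM) => -> ->.
have n1 : t (i + 1) - t i != 0 by rewrite subr_eq0 gt_eqF.
have n2 : t i - t (i - 1) != 0 by rewrite subr_eq0 gt_eqF.
rewrite /= !hornerE /=.
have e0 (b : bool) x : (b%:R : {poly R}).[x] = b%:R.
  by rewrite -polyC_natr hornerC.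
rewrite !e0.
have [->|ji] := eqVneq j i.
  have -> : (i == i - 1) = false by lia.
  have -> : (i + 1 == i) = false by lia.
  have -> : (i + 1 == i - 1) = false by lia.
  by rewrite subrr; ring.
have [ji1|ji1] := eqVneq j (i - 1); last first.
  have -> : (j + 1 == i) = false by lia.
  have [ji2|//] := eqVneq (j + 1) (i - 1).
  have -> : j + 1%:Z + 1 = i by lia.
  by rewrite subrr; ring.
have -> : j + 1 = i by lia.
have -> : (i == i - 1) = false by lia.
by rewrite eqxx ji1 !mulr0 !mulr1 addr0 add0r !mulVf.
Qed.

Lemma bspline_supp q j x :
  ~~ (t j <= x <= t (j + q%:Z + 1)) -> bspline t q j x = 0.
Proof.
elim: q j => [|q IH] j out /=.
  rewrite indicE memNset//= => -[/andP[jx xj]|[[/ltW jj _] xE]];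
    move/negP: out; apply.
    by rewrite jx /= addr0 ltW.
  by rewrite xE jj /= addr0.
rewrite !IH ?mulr0 ?addr0//;
  apply: contra out => /andP[x1 x2]; apply/andP; split.
- by apply: le_trans x1; apply: t_mono; lia.
- by apply: le_trans x2 _; apply: t_mono; lia.
- exact: x1.
- by apply: le_trans x2 _; apply: t_mono; lia.
Qed.
End Pieces.

(** * Derivatives within a set *)

(** On a domain such as [0,1] this is the one-sided derivative at an end
point. *)
Definition within_deriv (R : realType) (E : set R) (f : R -> R) (x l : R) :
    Prop :=
  h^-1 * (f (x + h) - f x) @[h --> within [set h | E (x + h)] 0^'] --> l.

Section WithinDeriv.
Variables (R : realType) (E : set R).

(** For functions given by different formulas on the two sides of a point. *)
Lemma within_deriv_glue (f g1 g2 : R -> R) (x l : R) :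
  f x = g1 x -> f x = g2 x ->
  (\forall h \near 0^', E (x + h) ->
     f (x + h) = g1 (x + h) \/ f (x + h) = g2 (x + h)) ->
  within_deriv E g1 x l -> within_deriv E g2 x l -> within_deriv E f x l.
Proof.
move=> fg1 fg2 fg d1 d2; apply/cvgrPdist_lt => e e0.
move/cvgrPdist_lt : d1 => /(_ e e0) d1.
move/cvgrPdist_lt : d2 => /(_ e e0) d2.
apply: (@filterS3 _ (0^' : set_system R) _ _ _ _ _ _ fg d1 d2).
move=> h fgh dh1 dh2 Eh.
case: (fgh Eh) => ->; first by rewrite fg1; exact: dh1.
by rewrite fg2; exact: dh2.
Qed.

Lemma within_deriv_near (f g : R -> R) (x l : R) :
  f x = g x -> (\forall h \near 0^', E (x + h) -> f (x + h) = g (x + h)) ->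
  within_deriv E g x l -> within_deriv E f x l.
Proof.
move=> fg0 fg dg; apply: (within_deriv_glue fg0 fg0 _ dg dg).
by apply: filterS fg => h + Eh => /(_ Eh); left.
Qed.

Lemma within_deriv_horner (p : {poly R}) (x : R) :
  within_deriv E (horner p) x p^`().[x].
Proof.
apply: cvg_within_filter.
have -> : p^`().[x] = 'D_1 (horner p) x by have [_ ->] := @is_derive_poly R p x.
have := @derivable_horner R p x.
rewrite /derivable /derive.
have -> : (fun h => h^-1 *: ((horner p \o shift x) (h *: 1) - p.[x])) =
    (fun h => h^-1 * (p.[x + h] - p.[x])).
  by apply/funext => h; rewrite /= /GRing.scale /= mulr1 (addrC x).
exact.
Qed.

Lemma within_derivD (f g : R -> R) (x k l : R) :
  within_deriv E f x k -> within_deriv E g x l ->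
  within_deriv E (fun y => f y + g y) x (k + l).
Proof.
move=> df dg; have := cvgD df dg.
rewrite /within_deriv.
have -> : (fun h => h^-1 * (f (x + h) - f x))
      + (fun h => h^-1 * (g (x + h) - g x)) =
    (fun h => h^-1 * (f (x + h) + g (x + h) - (f x + g x))).
  by apply/funext => h; rewrite fctE /= -mulrDr addrACA opprD.
exact.
Qed.

Lemma within_deriv_cst (c x : R) : within_deriv E (cst c) x 0.
Proof.
rewrite /within_deriv; under eq_fun do rewrite subrr mulr0.
exact: cvg_cst.
Qed.

Lemma within_deriv_sum (I : Type) (r : seq I) (f : I -> R -> R) (x : R)
    (l : I -> R) :
  (forall i, within_deriv E (f i) x (l i)) ->
  within_deriv E (fun y => \sum_(i <- r) f i y) x (\sum_(i <- r) l i).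
Proof.
move=> d; elim: r => [|i r IH].
  rewrite big_nil; under eq_fun do rewrite big_nil; exact: within_deriv_cst.
rewrite big_cons; under eq_fun do rewrite big_cons.
exact: within_derivD (d i) IH.
Qed.

Lemma within_deriv_shift (f : R -> R) (x l c : R) :
  within_deriv [set y | E (y - c)] f (x + c) l ->
  within_deriv E (fun y => f (y + c)) x l.
Proof.
rewrite /within_deriv /=.
have -> : [set h | E (x + c + h - c)] = [set h | E (x + h)].
  by congr mkset; apply/funext => h; congr E; ring.
by under eq_fun do rewrite addrAC.
Qed.
End WithinDeriv.

(** * The derivative of a B-spline *)

(** On the right of x the cell of x continues, unless the domain stops there.
On the left it continues too, unless x is its left knot; then the domain stops
there or a nonempty cell precedes, in which case the pieces of both cells must
have the same derivative at x, which takes degree at least 2. *)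
Lemma bspline_deriv (R : realType) (t : int -> R) (E : set R) (i : int)
    (p : nat) (j : int) (x : R) :
  {homo t : a b / a <= b} -> knot_interval t i x ->
  (x = t i -> (0 < p)%N /\ t (i - 1) < t i \/ forall y, E y -> x <= y) ->
  (x = t (i + 1) -> forall y, E y -> y <= x) ->
  within_deriv E (bspline t p.+1 j) x
    (p.+1%:R * ((t (j + p.+1%:Z) - t j)^-1 * bspline t p j x
      - (t (j + p.+1%:Z + 1) - t (j + 1))^-1 * bspline t p (j + 1) x)).
Proof.
move=> t_mono xi hl hr.
have lei : t i <= x by case: xi => [/andP[]//|[[lt _] ->]]; exact: ltW.
have lti : t i < t (i + 1).
  by case: xi => [/andP[]|[[]]//]; exact: le_lt_trans.
have lex : x <= t (i + 1) by case: xi => [/andP[_ /ltW]//|[_ ->]].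
have right : \forall h \near 0^',
    0 < h -> E (x + h) -> knot_interval t i (x + h).
  have [xr|xr] := eqVneq x (t (i + 1)).
    by near=> h => h0 /(hr xr); rewrite gerDl leNgt h0.
  have {}xr : 0 < t (i + 1) - x by rewrite subr_gt0 lt_neqAle xr.
  near=> h => h0 _; left; rewrite ler_wpDr//= ?(ltW h0)//.
  by rewrite -ltrBrDl -(gtr0_norm h0); near: h; exact: dnbhs0_lt.
set l := _ * _.
have lE : l = (bpiece t i p.+1 j)^`().[x].
  by rewrite /l deriv_bpiece// !(bspline_piece _ _ _ xi)// !hornerE.
have fE := bspline_piece t_mono p.+1 j xi.
have dr := @within_deriv_horner _ E (bpiece t i p.+1 j) x.
have nz : \forall h \near (0^' : set_system R), h != 0.
  exact: nbhs_dnbhs_neq.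
have [left|[xl p0 lt]] :
    (\forall h \near 0^', h < 0 -> E (x + h) -> knot_interval t i (x + h)) \/
    [/\ x = t i, (0 < p)%N & t (i - 1) < t i].
- have [xl|xl] := eqVneq x (t i).
    have [[p0 lt]|xmin] := hl xl; [by right|left].
    by near=> h => h0 /xmin; rewrite lerDl leNgt h0.
  have {}xl : 0 < x - t i by rewrite subr_gt0 lt_neqAle eq_sym xl.
  left; near=> h => h0 _; left; apply/andP; split; last first.
    by apply: lt_le_trans lex; rewrite gtrDl.
  rewrite -lerBlDl -lerN2 opprB -(ltr0_norm h0).
  by near: h; apply: dnbhs0_le.
- rewrite lE; apply: within_deriv_near dr => //.
  apply: filterS3 nz left right => h h0 hL hR Eh.
  apply: bspline_piece => //.
  by move: h0; rewrite neq_lt => /orP[/hL|/hR]; exact.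
(* At a simple knot, the piece of the previous cell takes over on the left; it
   has the same value and the same derivative at the knot. *)
have left : \forall h \near 0^', h < 0 -> knot_interval t (i - 1) (x + h).
  have d0 : 0 < t i - t (i - 1) by rewrite subr_gt0.
  near=> h => h0; left; rewrite subrK xl gtrDl h0 andbT.
  rewrite -lerBlDl -lerN2 opprB -(ltr0_norm h0).
  by near: h; apply: dnbhs0_le.
have fE' : bspline t p.+1 j x = (bpiece t (i - 1) p.+1 j).[x].
  by rewrite fE xl bpiece_knot.
have dE : (bpiece t i p.+1 j)^`().[x] = (bpiece t (i - 1) p.+1 j)^`().[x].
  case: (p) p0 => // q _; rewrite !deriv_bpiece// xl.
  have := bpiece_knot q j lt lti; have := bpiece_knot q (j + 1) lt lti.
  do 4!move: (bpiece t _ q.+1 _) => ?.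
  by move=> e1 e2; rewrite !hornerE e1 e2.
have dl := @within_deriv_horner _ E (bpiece t (i - 1) p.+1 j) x.
rewrite lE; apply: (within_deriv_glue fE fE' _ dr); last by rewrite dE.
apply: filterS3 nz left right => h h0 hL hR Eh.
move: h0; rewrite neq_lt => /orP[/hL|/hR/(_ Eh)] xh; [right|left];
  exact: bspline_piece.
Unshelve. all: by end_near. Qed.

(** * The two knot sequences *)

Section KnotVectors.
Variables (R : realType) (n : nat).
Hypothesis n0 : (0 < n)%N.

Lemma uniform_knot_mono : {homo uniform_knot R n : a b / a <= b}.
Proof.
by move=> a b ab; rewrite /uniform_knot ler_wpM2r ?invr_ge0// ler_int lerD2r.
Qed.

Lemma clamped_knot_mono : {homo clamped_knot R n : a b / a <= b}.
Proof.
move=> a b ab; rewrite /clamped_knot.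
have nR : 0 < n%:R :> R by rewrite ltr0n.
have [a1|a1] := leP a 1.
  have [//|b1] := leP b 1; case: (leP b) => [bn|_]; last exact: ler01.
  by rewrite mulr_ge0 ?invr_ge0// ler0z subr_ge0 ltW.
have [b1|b1] := leP b 1; first by lia.
have [an|an] := leP a (n%:Z + 1); last first.
  by have [bn|bn] := leP b (n%:Z + 1) => //; lia.
have [bn|bn] := leP b (n%:Z + 1).
  by rewrite ler_wpM2r ?invr_ge0// ler_int lerD2r.
rewrite ler_pdivrMr// mul1r -[leRHS]/(n%:Z%:~R : R) ler_int; lia.
Qed.

Lemma clamped_knotE (j : int) :
  1 <= j <= n%:Z + 1 -> clamped_knot R n j = uniform_knot R n j.
Proof.
rewrite /clamped_knot /uniform_knot => /andP[j1 jn]; rewrite jn.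
case: leP => // j1'; have -> : j = 1 by lia.
by rewrite subrr mul0r.
Qed.

Lemma uniform_cell (x : R) : exists i : int,
  uniform_knot R n i <= x < uniform_knot R n (i + 1).
Proof.
have nR : 0 < n%:R :> R by rewrite ltr0n.
exists (Num.floor (x * n%:R) + 1); rewrite /uniform_knot !addrK.
by rewrite ler_pdivrMr// ltr_pdivlMr// floor_le_tmp floorD1_gt.
Qed.

Lemma uniform_knot_lt (i : int) : uniform_knot R n (i - 1) < uniform_knot R n i.
Proof.
by rewrite /uniform_knot ltr_pM2r ?invr_gt0 ?ltr0n// ltr_int; lia.
Qed.

(** The hypotheses of [bspline_deriv] for the clamped knots. The point 1
belongs to the last nonempty cell, which is closed. *)
Lemma clamped_cell (x : R) : 0 <= x <= 1 -> exists2 i : int,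
  knot_interval (clamped_knot R n) i x &
  (x = clamped_knot R n i ->
     clamped_knot R n (i - 1) < clamped_knot R n i \/ x = 0)
  /\ (x = clamped_knot R n (i + 1) -> x = 1).
Proof.
move=> /andP[x0 x1].
have nR : 0 < n%:R :> R by rewrite ltr0n.
have un : uniform_knot R n (n%:Z + 1) = 1.
  by rewrite /uniform_knot addrK mulfV// gt_eqF.
have u1 : uniform_knot R n 1 = 0 by rewrite /uniform_knot subrr mul0r.
move: x1; rewrite le_eqVlt => /predU1P[->|x1].
  have lt : clamped_knot R n n%:Z < clamped_knot R n (n%:Z + 1).
    rewrite !clamped_knotE; try lia.
    by have := uniform_knot_lt (n%:Z + 1); rewrite addrK.
  have e1 : clamped_knot R n (n%:Z + 1) = 1 by rewrite clamped_knotE ?un//; lia.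
  exists n%:Z; last first.
    by split=> // e; move: lt; rewrite -e e1 ltxx.
  right; split=> //; split=> // k nk.
  have [->//|kn] := eqVneq k (n%:Z + 1).
  by rewrite e1 /clamped_knot ifF ?ifF//; lia.
have [i /andP[ix xi]] := uniform_cell x.
have i1 : 1 <= i.
  rewrite leNgt; apply/negP => i1; move: xi; rewrite ltNge => /negP; apply.
  by apply: le_trans x0; rewrite -u1; apply: uniform_knot_mono; lia.
have iN : i <= n%:Z.
  rewrite leNgt; apply/negP => i2; move: ix; rewrite leNgt => /negP; apply.
  by apply: lt_le_trans x1 _; rewrite -un; apply: uniform_knot_mono; lia.
exists i; first by left; rewrite !clamped_knotE ?ix//; lia.
split=> [|e]; last first.
  by move: xi; rewrite [ltRHS](_ : _ = x) ?ltxx// e clamped_knotE//; lia.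
move: i1; rewrite le_eqVlt => /predU1P[<-|i1] e.
  by right; rewrite e clamped_knotE ?u1//; lia.
by left; rewrite !clamped_knotE ?uniform_knot_lt//; lia.
Qed.
End KnotVectors.

(** * Univariate spline rows *)

Section Univariate.
Variables (R : realType) (n : nat).
Hypothesis n0 : (0 < n)%N.

Lemma sum_row_delta (N : nat) (v : 'rV[R]_N) (m : nat) :
  \sum_(i < N) v 0 i * (i == m :> nat)%:R =
  if insub m is Some i then v 0 i else 0.
Proof.
case: insubP => [i _ <-|mN].
  rewrite (bigD1 i)//= eqxx mulr1 big1 ?addr0// => k ki.
  by rewrite (negbTE (ki : val k != val i)) mulr0.
apply: big1 => i _; case: eqP => [im|]; last by rewrite mulr0.
by rewrite -im ltn_ord in mN.
Qed.

(** The first diagonal entry is covered as well: its knots t_{1-p}, ..., t_1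
coincide, so that the quotient is p / 0 = 0. *)
Lemma clamped_DE p (i k : 'I_(n + p)) :
  let t := clamped_knot R n in let j := clamped_index p k in
  clamped_D R n p i k =
    (i == k :> nat)%:R * (p%:R / (t (j + p%:Z) - t j))
    - (i == k.+1 :> nat)%:R * (p%:R / (t (j + p%:Z + 1) - t (j + 1))).
Proof.
move=> t j; rewrite mxE -/t -/j val_eqE; have [->|ik] := eqVneq i k; last first.
  by case: eqP => _ /=; ring.
have -> : (k == k.+1 :> nat) = false by lia.
case: (posnP k) => k0 /=; last by ring.
rewrite [t (j + _)](_ : _ = t j) ?subrr ?invr0; first by ring.
by rewrite /t /clamped_knot !ifT//; rewrite /j /clamped_index k0; lia.
Qed.

Lemma clamped_basis_mulD (p q : nat) (x : R) (k : 'I_(n + p)) :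
  (0 < p)%N ->
  let t := clamped_knot R n in let j := clamped_index p k in
  (clamped_basis n p q x *m clamped_D R n p) 0 k =
    p%:R * ((t (j + p%:Z) - t j)^-1 * bspline t q j x
            - (t (j + p%:Z + 1) - t (j + 1))^-1 * bspline t q (j + 1) x).
Proof.
move=> p0 t j; pose b := clamped_basis n p q x.
rewrite mxE; transitivity (\sum_i (p%:R * (t (j + p%:Z) - t j)^-1
    * (b 0 i * (i == k :> nat)%:R)
  + - (p%:R * (t (j + p%:Z + 1) - t (j + 1))^-1)
    * (b 0 i * (i == k.+1 :> nat)%:R))).
  by apply: eq_bigr => i _; rewrite clamped_DE -/t -/j -/b; ring.
rewrite big_split/= -!mulr_sumr !sum_row_delta valK.
case: insubP => [i _ ik|kN].
  rewrite /b !mxE ik.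
  have -> : clamped_index p k.+1 = j + 1 by rewrite /j /clamped_index; lia.
  by rewrite -/j; ring.
(* In the last column the second B-spline lives on the collapsed knots at 1,
   where its weight is 1 / 0 = 0. *)
rewrite /b mxE -/j [t (j + _ + 1)](_ : _ = t (j + 1)) ?subrr ?invr0.
  by ring.
have jn : j = n%:Z by have := ltn_ord k; rewrite /j /clamped_index; lia.
rewrite /t jn [RHS]clamped_knotE//; last by lia.
rewrite /clamped_knot ifF; last by lia.
rewrite ifF; last by lia.
by rewrite /uniform_knot addrK mulfV// pnatr_eq0 -lt0n.
Qed.

Lemma clamped_deriv (p : nat) (x : R) (k : 'I_(n + p)) :
  (0 < p)%N -> 0 <= x <= 1 ->
  (p = 1%N -> forall j, x != clamped_knot R n j) ->
  within_deriv [set y | 0 <= y <= 1] (fun y => clamped_basis n p p y 0 k) x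
    ((clamped_basis n p p.-1 x *m clamped_D R n p) 0 k).
Proof.
move=> p0 x01 off; rewrite clamped_basis_mulD//.
rewrite [X in within_deriv _ X](_ : _ =
    bspline (clamped_knot R n) p (clamped_index p k)); last first.
  by apply/funext => y; rewrite mxE.
have [i xi [il ir]] := clamped_cell n0 x01.
case: p p0 k off => // p _ k off.
rewrite succnK; apply: (bspline_deriv (clamped_knot_mono R n0) xi).
- move=> xE; case: p k off => [|p] k off; last first.
    by case: (il xE) => [|->]; [left|right=> y /andP[]].
  by case/eqP: (off erefl i).
- by move=> /ir -> y /andP[].
Qed.

Lemma uniform_last (i : int) : ~ last_interval (uniform_knot R n) i.
Proof.
move=> [_ /(_ (i + 2))].
have := uniform_knot_lt R n0 (i + 2); rewrite -addrA => lt /(_ _).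
by rewrite leNgt lt => H; suff : false by []; apply: H; rewrite ltrDl.
Qed.

Lemma uniform_deriv (p : nat) (j : int) (x : R) :
  (p = 0%N -> forall j, x != uniform_knot R n j) ->
  within_deriv setT (bspline (uniform_knot R n) p.+1 j) x
    (n%:R * (bspline (uniform_knot R n) p j x
             - bspline (uniform_knot R n) p (j + 1) x)).
Proof.
move=> off; set t := uniform_knot R n.
have nR : n%:R != 0 :> R by rewrite pnatr_eq0 -lt0n.
have [i ix] := uniform_cell n0 x.
have dE k : t (k + p.+1%:Z) - t k = p.+1%:R / n%:R.
  rewrite /t /uniform_knot -mulrBl -rmorphB; congr (_ / _).
  by rewrite -[RHS]/(p.+1%:Z%:~R : R); congr (_%:~R); ring.
rewrite [X in within_deriv _ _ _ X](_ : _ =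
    p.+1%:R * ((t (j + p.+1%:Z) - t j)^-1 * bspline t p j x
      - (t (j + p.+1%:Z + 1) - t (j + 1))^-1 * bspline t p (j + 1) x)).
  apply: (bspline_deriv (uniform_knot_mono R n) (or_introl ix)).
  - move=> xE; left; rewrite uniform_knot_lt//; split=> //.
    by case: p off {dE} => // /(_ erefl i); rewrite xE eqxx.
  - by move=> xE; case/andP: ix => _; rewrite -xE ltxx.
have pR : p.+1%:R != 0 :> R by rewrite pnatr_eq0.
by rewrite -addrAC !dE; field; rewrite nR nat1r pR.
Qed.

Definition periodise (f : R -> R) (x : R) : R :=
  \sum_(m \in [set: int]) f (x + m%:~R).

(** The same finite range of translates serves all points near x and all
functions supported in [-B, B], which makes sums over the integers
differentiable and additive like finite sums. *)
Lemma periodise_finite (B x : R) : exists2 r : seq int, uniq r &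
  forall f : R -> R, (forall y, B < `|y| -> f y = 0) ->
  forall y, `|y - x| < 1 -> periodise f y = \sum_(m <- r) f (y + m%:~R).
Proof.
pose M := Num.bound (`|B| + `|x| + 1).
pose r := [seq k%:Z - M%:Z | k <- iota 0 (M + M).+1].
have ur : uniq r.
  by rewrite map_inj_uniq; [exact: iota_uniq|move=> a b /addIr []].
exists r => // f f0 y xy; rewrite /periodise (fsbigE r)//.
  by apply: eq_bigl => m; rewrite in_setT.
move=> m _ mr; apply: f0.
have Mm : M%:Z < `|m|.
  rewrite ltNge; apply: contra mr => mM; apply/mapP.
  exists (absz (m + M%:Z)); last by lia.
  by rewrite mem_iota; lia.
have : `|B| + `|x| + 1 < M%:R by rewrite archi_boundP ?addr_ge0.
have : M%:R < `|m%:~R| :> R.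
  by rewrite -intr_norm -[ltLHS]/(M%:Z%:~R : R) ltr_int.
have := ler_norm B.
have : `|m%:~R| <= `|y + m%:~R| + `|x| + `|y - x|.
  rewrite [leLHS](_ : _ = `|(y + m%:~R) - x - (y - x)|); last first.
    by congr `|_|; ring.
  by rewrite (le_trans (ler_normB _ _))// lerD2r ler_normB.
lra.
Qed.

Lemma periodise_shift (f : R -> R) x : periodise f (x + 1) = periodise f x.
Proof.
rewrite /periodise [RHS](reindex_fsbigT (fun m => m + 1))/=.
  by apply: eq_fsbigr => m _; congr f; ring.
by exists (fun m => m - 1) => m; rewrite ?addrK ?subrK.
Qed.

Lemma within_deriv_periodise (f f' : R -> R) (B x : R) :
  (forall y, B < `|y| -> f y = 0) -> (forall y, B < `|y| -> f' y = 0) ->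
  (forall m : int, within_deriv setT f (x + m%:~R) (f' (x + m%:~R))) ->
  within_deriv setT (periodise f) x (periodise f' x).
Proof.
move=> f0 f'0 df; have [r _ rE] := periodise_finite B x.
rewrite (rE f')// ?subrr ?normr0//.
apply: (@within_deriv_near _ _ _ (fun y => \sum_(m <- r) f (y + m%:~R))).
- by rewrite (rE f)// subrr normr0.
- near=> h => _; rewrite (rE f)// addrAC subrr add0r.
  by near: h; exact: dnbhs0_lt.
- apply: within_deriv_sum => m.
  exact: (@within_deriv_shift _ setT f x _ m%:~R).
Unshelve. all: by end_near. Qed.

Lemma uniform_bspline_shift q (j : int) (y : R) :
  bspline (uniform_knot R n) q (j + n%:Z) (y + 1)
  = bspline (uniform_knot R n) q j y.
Proof.
have nR : n%:R != 0 :> R by rewrite pnatr_eq0 -lt0n.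
have tE k : uniform_knot R n (k + n%:Z) = uniform_knot R n k + 1.
  by rewrite /uniform_knot addrAC rmorphD/= mulrDl mulfV.
elim: q j => [|q IH] j /=.
  rewrite !indicE; congr (_%:R); congr nat_of_bool.
  apply/idP/idP; rewrite !inE /knot_interval /= => -[yj|[/uniform_last//]];
    by left; move: yj; rewrite addrAC !tE lerD2r ltrD2r.
rewrite -!IH.
have -> : j + n%:Z + q.+1%:Z = j + q.+1%:Z + n%:Z by ring.
have -> : j + q.+1%:Z + n%:Z + 1 = j + q.+1%:Z + 1 + n%:Z by ring.
have -> : j + n%:Z + 1 = j + 1 + n%:Z by ring.
by rewrite !tE; congr (_ / _ * _ + _ / _ * _); ring.
Qed.

(** The identification of indices modulo n behind the corner entry of the
circulant matrix: advancing the index by n is a translation by one period. *)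
Lemma periodise_bspline_wrap q (k : nat) (x : R) : (k < n)%N ->
  periodise (bspline (uniform_knot R n) q (k.+1%:Z + 1)) x =
  periodise (bspline (uniform_knot R n) q ((k.+1 %% n)%N%:Z + 1)) x.
Proof.
rewrite leq_eqVlt => /predU1P[kn|kn]; last by rewrite modn_small.
rewrite kn modnn add0r addrC -[in LHS](periodise_shift _ x).
rewrite /periodise; apply: eq_fsbigr => m _.
by rewrite addrAC uniform_bspline_shift.
Qed.

Lemma periodic_basis_mulD (q : nat) (x : R) (k : 'I_n) :
  (periodic_basis n q x *m periodic_D R n) 0 k =
    n%:R * (periodise (bspline (uniform_knot R n) q (k%:Z + 1)) x
            - periodise (bspline (uniform_knot R n) q (k%:Z + 1 + 1)) x).
Proof.
have -> : k%:Z + 1 + 1 = k.+1%:Z + 1 by lia.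
rewrite periodise_bspline_wrap//; pose b := periodic_basis n q x.
rewrite mxE; transitivity (\sum_i (n%:R * (b 0 i * (i == k :> nat)%:R)
  + - n%:R * (b 0 i * (i == (k.+1 %% n)%N :> nat)%:R))).
  by apply: eq_bigr => i _; rewrite [periodic_D _ _ _ _]mxE; ring.
rewrite big_split/= -!mulr_sumr !sum_row_delta valK insubT ?ltn_mod// => kn.
by rewrite /b !mxE -/(periodise _ _) mulNr mulrBr.
Qed.

Lemma periodic_deriv (p : nat) (x : R) (k : 'I_n) :
  (0 < p)%N -> (p = 1%N -> forall j, x != uniform_knot R n j) ->
  within_deriv setT (fun y => periodic_basis n p y 0 k) x
    ((periodic_basis n p.-1 x *m periodic_D R n) 0 k).
Proof.
case: p => // p _ off; pose t := uniform_knot R n.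
rewrite [X in within_deriv _ X](_ : _ =
    periodise (bspline t p.+1 (k%:Z + 1))); last first.
  by apply/funext => y; rewrite mxE.
(* The three B-splines of the derivative formula live on the knots with index
   from k + 1 to k + p + 3. *)
pose B := `|t (k%:Z + 1)| + `|t (k%:Z + p%:Z + 3)|.
have mono := uniform_knot_mono R n.
have supp q (j : int) : k%:Z + 1 <= j -> j + q%:Z + 1 <= k%:Z + p%:Z + 3 ->
    forall y, B < `|y| -> bspline t q j y = 0.
  move=> kj jp y; rewrite ltNge => By; apply: bspline_supp => //.
  apply: contra By => /andP[jy yj]; rewrite /B.
  have := le_trans (mono _ _ kj) jy; have := le_trans yj (mono _ _ jp).
  have := ler_norm (- t (k%:Z + 1)); have := normr_ge0 (t (k%:Z + 1)).
  have := ler_norm (t (k%:Z + p%:Z + 3)).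
  have := normr_ge0 (t (k%:Z + p%:Z + 3)).
  by rewrite normrN -/t ler_norml => *; apply/andP; split; lra.
pose f' y := n%:R * (bspline t p (k%:Z + 1) y - bspline t p (k%:Z + 1 + 1) y).
have f'0 y : B < `|y| -> f' y = 0.
  by move=> By; rewrite /f' !supp ?subrr ?mulr0//; lia.
have -> : (periodic_basis n p x *m periodic_D R n) 0 k = periodise f' x.
  have [r _ rE] := periodise_finite B x.
  have xx : `|x - x| < 1 by rewrite subrr normr0.
  rewrite (rE f')// -mulr_sumr sumrB -!rE//; try by apply: supp; lia.
  exact: periodic_basis_mulD.
apply: (within_deriv_periodise (B := B)) => //.
- by apply: supp; lia.
- move=> m; apply: uniform_deriv => p0 j.
  apply/eqP => xm; have /eqP := off (congr1 S p0) (j - m * n%:Z); apply.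
  have nR : n%:R != 0 :> R by rewrite pnatr_eq0 -lt0n.
  rewrite -[x](addrK m%:~R) xm /uniform_knot.
  by rewrite addrAC [in RHS]intrB intrM mulrBl mulfK.
Qed.
End Univariate.

(** * Block matrices *)

Section Blocks.
Variable R : pzRingType.

Lemma row3_mulmx_col3 m n1 n2 n3 n
    (A : 'M[R]_(m, n1)) (B : 'M[R]_(m, n2)) (C : 'M[R]_(m, n3))
    (D : 'M[R]_(n1, n)) (E : 'M[R]_(n2, n)) (F : 'M[R]_(n3, n)) :
  row3 A B C *m col3 D E F = A *m D + B *m E + C *m F.
Proof. by rewrite !mul_row_col. Qed.

Lemma col3_mulmx m1 m2 m3 n k
    (A : 'M[R]_(m1, n)) (B : 'M[R]_(m2, n)) (C : 'M[R]_(m3, n))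
    (M : 'M[R]_(n, k)) :
  col3 A B C *m M = col3 (A *m M) (B *m M) (C *m M).
Proof. by rewrite !mul_col_mx. Qed.

(** The row dimension 3 is only convertible to 1 + 1 + 1, which hides the
block structure from rewriting. *)
Lemma col3row_mulmx n k (A B C : 'rV[R]_n) (M : 'M[R]_(n, k)) :
  (col3 A B C : 'M[R]_(3, n)) *m M = col3 (A *m M) (B *m M) (C *m M).
Proof. exact: (@col3_mulmx 1 1 1). Qed.

Lemma mulmx_row3 m n1 n2 n3 k
    (A : 'M[R]_(m, n1)) (B : 'M[R]_(m, n2)) (C : 'M[R]_(m, n3))
    (M : 'M[R]_(k, m)) :
  M *m row3 A B C = row3 (M *m A) (M *m B) (M *m C).
Proof. by rewrite !mul_mx_row. Qed.

Lemma add_row3 m n1 n2 n3 (A A' : 'M[R]_(m, n1)) (B B' : 'M[R]_(m, n2))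
    (C C' : 'M[R]_(m, n3)) :
  row3 A B C + row3 A' B' C' = row3 (A + A') (B + B') (C + C').
Proof. by rewrite !add_row_mx. Qed.

Lemma opp_row3 m n1 n2 n3 (A : 'M[R]_(m, n1)) (B : 'M[R]_(m, n2))
    (C : 'M[R]_(m, n3)) : - row3 A B C = row3 (- A) (- B) (- C).
Proof. by rewrite !opp_row_mx. Qed.

Lemma row30 m n1 n2 n3 : row3 0 0 0 = 0 :> 'M[R]_(m, n1 + n2 + n3).
Proof. by rewrite /row3 !row_mx0. Qed.

Lemma col30 m1 m2 m3 n : col3 0 0 0 = 0 :> 'M[R]_(m1 + m2 + m3, n).
Proof. by rewrite /col3 !col_mx0. Qed.

Lemma col3E n (A B C : 'rV[R]_n) j (M := col3 A B C : 'M[R]_(3, n)) :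
  [/\ M 0 j = A 0 j, M 1 j = B 0 j & M 2 j = C 0 j].
Proof.
split.
- transitivity (col_mx (col_mx A B) C (lshift 1 (lshift 1 0)) j).
    by congr (col_mx _ _ _ _); exact: val_inj.
  by rewrite !col_mxEu.
- transitivity (col_mx (col_mx A B) C (lshift 1 (rshift 1 0)) j).
    by congr (col_mx _ _ _ _); exact: val_inj.
  by rewrite col_mxEu col_mxEd.
- transitivity (col_mx (col_mx A B) C (rshift (1 + 1) 0) j).
    by congr (col_mx _ _ _ _); exact: val_inj.
  by rewrite col_mxEd.
Qed.

End Blocks.

(** * Partial derivatives *)

Lemma ord3P (i : 'I_3) : [\/ i = 0, i = 1 | i = 2].
Proof.
by case: i => -[|[|[|//]]] ?; [apply: Or31|apply: Or32|apply: Or33];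
  exact: val_inj.
Qed.

Section Derivatives.
Variable R : realType.
Implicit Types xi : 'rV[R]_3.

Lemma coordD xi h (i k : 'I_3) :
  (xi + h *: delta_mx 0 i) 0 k = xi 0 k + h * (k == i)%:R.
Proof. by rewrite !mxE. Qed.

Definition is_pderiv (i : 'I_3) (f : 'rV[R]_3 -> R) xi (l : R) : Prop :=
  dquot i f xi h @[h --> increments i xi] --> l.

(** Limits along the admissible increments are unique: from a point of the
left half of [0,1] one can move to the right, from a point of the right half
to the left. *)
Lemma increments_proper i xi : xi_dom xi -> ProperFilter (increments i xi).
Proof.
move=> /andP[x0 x1]; split; last exact: within_filter.
move=> /nbhs_ballP[e /= e0 He].
pose d := Num.min e 1 / 2.
have me : Num.min e 1 <= e by rewrite ge_min lexx.
have m1 : Num.min e 1 <= 1 by rewrite ge_min lexx orbT.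
have m0 : 0 < Num.min e 1 by rewrite lt_min e0 ltr01.
have d0 : 0 < d by rewrite divr_gt0.
have de : d < e by rewrite /d; lra.
have d12 : d <= 1 / 2 by rewrite /d; lra.
have {}He (s : R) : `|s| = d -> ~ (0 <= xi 0 0 + s <= 1).
  move=> sd xs; have s0 : s != 0 by rewrite -normr_gt0 sd.
  apply: (He s _ s0); first by rewrite /ball/= sub0r normrN sd.
  rewrite /xi_dom/= !mxE; case: (0 == i); rewrite ?mulr1// ?mulr0 ?addr0.
  by rewrite x0 x1.
have [x12|x12] := leP (xi 0 0) (1 / 2).
  by apply: (He d); [rewrite gtr0_norm|lra].
by apply: (He (- d)); [rewrite normrN gtr0_norm|lra].
Qed.

Lemma is_pderivP i f xi l : xi_dom xi -> is_pderiv i f xi l ->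
  pderivable i f xi /\ pderiv i f xi = l.
Proof.
move=> xid df; have pf := increments_proper i xid.
by split; [apply/cvg_ex; exists l|apply: cvg_lim].
Qed.

Definition coord_dom (i : 'I_3) : set R :=
  if i == 0 then [set x | 0 <= x <= 1] else setT.

Lemma incrementsE i xi : xi_dom xi ->
  increments i xi = within [set h | coord_dom i (xi 0 i + h)] 0^'.
Proof.
move=> /andP[x0 x1]; rewrite /increments.
suff -> : [set h | xi_dom (xi + h *: delta_mx 0 i)] =
  [set h | coord_dom i (xi 0 i + h)] by [].
apply/seteqP; rewrite /coord_dom /xi_dom.
have [->|i0] := eqVneq i 0; split => h /=; rewrite !mxE ?eqxx/= ?mulr1//.
by rewrite eq_sym (negbTE i0) mulr0 addr0 x0 x1.
Qed.

Lemma is_pderivM i (c : 'rV[R]_3 -> R) (g : R -> R) xi l : xi_dom xi ->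
  (forall h, c (xi + h *: delta_mx 0 i) = c xi) ->
  within_deriv (coord_dom i) g (xi 0 i) l ->
  is_pderiv i (fun y => c y * g (y 0 i)) xi (c xi * l).
Proof.
move=> xid cE dg; rewrite /is_pderiv incrementsE//.
have -> : dquot i (fun y => c y * g (y 0 i)) xi =
    (fun h => c xi * (h^-1 * (g (xi 0 i + h) - g (xi 0 i)))).
  by apply/funext => h; rewrite /dquot cE !mxE !eqxx mulr1; ring.
exact: cvgMl_tmp dg.
Qed.

Lemma eq_is_pderiv i f g xi l :
  f =1 g -> is_pderiv i g xi l -> is_pderiv i f xi l.
Proof. by move=> /funext ->. Qed.

Definition row_pderiv i N (A : 'rV[R]_3 -> 'rV[R]_N) xi (L : 'rV[R]_N) : Prop :=
  forall j, is_pderiv i (fun y => A y 0 j) xi (L 0 j).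

Lemma is_pderiv0 i xi : is_pderiv i (fun=> 0) xi 0.
Proof.
rewrite /is_pderiv (_ : dquot _ _ _ = cst 0); first exact: cvg_cst.
by apply/funext => h; rewrite /dquot subrr mulr0.
Qed.

Lemma row_pderiv0 i N xi : row_pderiv i (fun=> 0 : 'rV[R]_N) xi 0.
Proof. by move=> j; rewrite mxE; exact: is_pderiv0. Qed.

Lemma row_pderiv_row3 i N1 N2 N3 xi
    (A : 'rV[R]_3 -> 'rV[R]_N1) (B : 'rV[R]_3 -> 'rV[R]_N2)
    (C : 'rV[R]_3 -> 'rV[R]_N3) LA LB LC :
  row_pderiv i A xi LA -> row_pderiv i B xi LB -> row_pderiv i C xi LC ->
  row_pderiv i (fun y => row3 (A y) (B y) (C y)) xi (row3 LA LB LC).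
Proof.
move=> dA dB dC j; rewrite /row3.
have [k ->|k ->] := split_ordP j; last first.
  by rewrite row_mxEr; apply: eq_is_pderiv (dC k) => y; rewrite row_mxEr.
have [k' ->|k' ->] := split_ordP k.
  by rewrite !row_mxEl; apply: eq_is_pderiv (dA k') => y; rewrite !row_mxEl.
rewrite row_mxEl row_mxEr; apply: eq_is_pderiv (dB k') => y.
by rewrite row_mxEl row_mxEr.
Qed.
End Derivatives.

(** * The tensor-product basis *)

Lemma tensmx3_mul (R : comPzRingType) m1 m2 m3 k1 k2 k3 l1 l2 l3
    (A : 'M[R]_(m1, k1)) (B : 'M[R]_(m2, k2)) (C : 'M[R]_(m3, k3))
    (A' : 'M[R]_(k1, l1)) (B' : 'M[R]_(k2, l2)) (C' : 'M[R]_(k3, l3)) :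
  (A *t B *t C) *m (A' *t B' *t C') = (A *m A') *t (B *m B') *t (C *m C').
Proof. by rewrite !tensmx_mul. Qed.

(** As for [col3row_mulmx], a single row has to be seen as 1 * 1 * 1 rows. *)
Lemma tensrow3_mul (R : comPzRingType) k1 k2 k3 l1 l2 l3
    (a : 'rV[R]_k1) (b : 'rV[R]_k2) (c : 'rV[R]_k3)
    (A : 'M[R]_(k1, l1)) (B : 'M[R]_(k2, l2)) (C : 'M[R]_(k3, l3)) :
  (a *t b *t c : 'rV[R]_(k1 * k2 * k3)) *m (A *t B *t C) =
  ((a *m A) *t (b *m B) *t (c *m C) : 'rV[R]_(l1 * l2 * l3)).
Proof. exact: (@tensmx3_mul R 1 1 1). Qed.

Section TensorBasis.
Variables (R : realType) (p n1 n2 n3 : nat).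

Lemma tens3E (a : 'rV[R]_(n1 + p)) (b : 'rV[R]_n2) (c : 'rV[R]_n3) :
  forall j : 'I_(dimN p n1 n2 n3),
  (a *t b *t c : 'rV[R]_(dimN p n1 n2 n3)) 0 j =
    a 0 (mxtens_unindex (mxtens_unindex j).1).1 *
    b 0 (mxtens_unindex (mxtens_unindex j).1).2 * c 0 (mxtens_unindex j).2.
Proof. by move=> j; rewrite mxE [X in X * _]mxE !ord1. Qed.

Local Notation D1 := (mxD1 R p n1 n2 n3).
Local Notation D2 := (mxD2 R p n1 n2 n3).
Local Notation D3 := (mxD3 R p n1 n2 n3).

Lemma mxD12C : D1 *m D2 = D2 *m D1.
Proof.
transitivity (clamped_D R n1 p *t periodic_D R n2 *t (1%:M : 'M[R]_n3)).
  by rewrite /mxD1 /mxD2 /mxD3 /dimN tensmx3_mul !(mulmx1, mul1mx).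
by symmetry; rewrite /mxD1 /mxD2 /mxD3 /dimN tensmx3_mul !(mulmx1, mul1mx).
Qed.

Lemma mxD13C : D1 *m D3 = D3 *m D1.
Proof.
transitivity (clamped_D R n1 p *t (1%:M : 'M[R]_n2) *t periodic_D R n3).
  by rewrite /mxD1 /mxD2 /mxD3 /dimN tensmx3_mul !(mulmx1, mul1mx).
by symmetry; rewrite /mxD1 /mxD2 /mxD3 /dimN tensmx3_mul !(mulmx1, mul1mx).
Qed.

Lemma mxD23C : D2 *m D3 = D3 *m D2.
Proof.
transitivity ((1%:M : 'M[R]_(n1 + p)) *t periodic_D R n2 *t periodic_D R n3).
  by rewrite /mxD1 /mxD2 /mxD3 /dimN tensmx3_mul !(mulmx1, mul1mx).
by symmetry; rewrite /mxD1 /mxD2 /mxD3 /dimN tensmx3_mul !(mulmx1, mul1mx).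
Qed.

Hypotheses (p0 : (0 < p)%N) (n10 : (0 < n1)%N) (n20 : (0 < n2)%N)
  (n30 : (0 < n3)%N).
Variable xi : 'rV[R]_3.
Hypotheses (xid : xi_dom xi) (off : p = 1%N -> off_knots n1 n2 n3 xi).

Let T q1 q2 q3 := @tens_basis R p n1 n2 n3 q1 q2 q3.

Lemma tens_pderiv1 q2 q3 : row_pderiv 0 (T p q2 q3) xi (T p.-1 q2 q3 xi *m D1).
Proof.
move=> j.
have -> : T p.-1 q2 q3 xi *m D1 =
    (clamped_basis n1 p p.-1 (xi 0 0) *m clamped_D R n1 p)
      *t periodic_basis n2 q2 (xi 0 1) *t periodic_basis n3 q3 (xi 0 2).
  by rewrite /T /tens_basis /mxD1 /mxD2 /mxD3 /dimN tensrow3_mul !mulmx1.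
rewrite tens3E; set k := mxtens_unindex j; set k' := mxtens_unindex k.1.
pose c (y : 'rV[R]_3) :=
  periodic_basis n2 q2 (y 0 1) 0 k'.2 * periodic_basis n3 q3 (y 0 2) 0 k.2.
rewrite [X in is_pderiv _ _ _ X](_ : _ = c xi *
  (clamped_basis n1 p p.-1 (xi 0 0) *m clamped_D R n1 p) 0 k'.1); last first.
  by rewrite /c; ring.
apply: (@eq_is_pderiv _ _ _
  (fun y => c y * clamped_basis n1 p p (y 0 0) 0 k'.1)).
  by move=> y; rewrite [LHS]tens3E /c -/k -/k'; ring.
apply: (is_pderivM (g := fun z => clamped_basis n1 p p z 0 k'.1)) => //.
  by move=> h; rewrite /c !coordD /= !mulr0 !addr0.
by apply: clamped_deriv => // p1 i; case: (off p1 i).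
Qed.

Lemma tens_pderiv2 q1 q3 : row_pderiv 1 (T q1 p q3) xi (T q1 p.-1 q3 xi *m D2).
Proof.
move=> j.
have -> : T q1 p.-1 q3 xi *m D2 = clamped_basis n1 p q1 (xi 0 0)
      *t (periodic_basis n2 p.-1 (xi 0 1) *m periodic_D R n2)
      *t periodic_basis n3 q3 (xi 0 2).
  by rewrite /T /tens_basis /mxD1 /mxD2 /mxD3 /dimN tensrow3_mul !mulmx1.
rewrite tens3E; set k := mxtens_unindex j; set k' := mxtens_unindex k.1.
pose c (y : 'rV[R]_3) :=
  clamped_basis n1 p q1 (y 0 0) 0 k'.1 * periodic_basis n3 q3 (y 0 2) 0 k.2.
rewrite [X in is_pderiv _ _ _ X](_ : _ = c xi *
  (periodic_basis n2 p.-1 (xi 0 1) *m periodic_D R n2) 0 k'.2); last first.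
  by rewrite /c; ring.
apply: (@eq_is_pderiv _ _ _
  (fun y => c y * periodic_basis n2 p (y 0 1) 0 k'.2)).
  by move=> y; rewrite [LHS]tens3E /c -/k -/k'; ring.
apply: (is_pderivM (g := fun z => periodic_basis n2 p z 0 k'.2)) => //.
  by move=> h; rewrite /c !coordD /= !mulr0 !addr0.
by apply: periodic_deriv => // p1 i; case: (off p1 i).
Qed.

Lemma tens_pderiv3 q1 q2 : row_pderiv 2 (T q1 q2 p) xi (T q1 q2 p.-1 xi *m D3).
Proof.
move=> j.
have -> : T q1 q2 p.-1 xi *m D3 = clamped_basis n1 p q1 (xi 0 0)
      *t periodic_basis n2 q2 (xi 0 1)
      *t (periodic_basis n3 p.-1 (xi 0 2) *m periodic_D R n3).
  by rewrite /T /tens_basis /mxD1 /mxD2 /mxD3 /dimN tensrow3_mul !mulmx1.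
rewrite tens3E; set k := mxtens_unindex j; set k' := mxtens_unindex k.1.
pose c (y : 'rV[R]_3) :=
  clamped_basis n1 p q1 (y 0 0) 0 k'.1 * periodic_basis n2 q2 (y 0 1) 0 k'.2.
rewrite [X in is_pderiv _ _ _ X](_ : _ = c xi *
  (periodic_basis n3 p.-1 (xi 0 2) *m periodic_D R n3) 0 k.2); last first.
  by rewrite /c; ring.
apply: (@eq_is_pderiv _ _ _ (fun y => c y * periodic_basis n3 p (y 0 2) 0 k.2)).
  by move=> y; rewrite [LHS]tens3E /c -/k -/k'; ring.
apply: (is_pderivM (g := fun z => periodic_basis n3 p z 0 k.2)) => //.
  by move=> h; rewrite /c !coordD /= !mulr0 !addr0.
by apply: periodic_deriv => // p1 i; case: (off p1 i).
Qed.
End TensorBasis.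

(** * The discrete de Rham sequence *)

Lemma curlM_gradM (R : realType) p n1 n2 n3 :
  curlM R p n1 n2 n3 *m gradM R p n1 n2 n3 = 0.
Proof.
rewrite /curlM /gradM col3_mulmx !row3_mulmx_col3.
rewrite !mul0mx !mulNmx !add0r !addr0 mxD12C mxD13C mxD23C.
by rewrite !addNr subrr col30.
Qed.

Lemma divM_curlM (R : realType) p n1 n2 n3 :
  divM R p n1 n2 n3 *m curlM R p n1 n2 n3 = 0.
Proof.
rewrite /divM /curlM row3_mulmx_col3 !mulmx_row3 !add_row3.
rewrite !mulmx0 !mulmxN !add0r !addr0 mxD12C mxD13C mxD23C.
by rewrite !subrr addNr row30.
Qed.

Section Operators.
Variables (R : realType) (xi : 'rV[R]_3).
Hypothesis xid : xi_dom xi.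

Lemma gradP N (A : 'rV[R]_3 -> 'rV[R]_N) (d0 d1 d2 : 'rV[R]_N) :
  row_pderiv 0 A xi d0 -> row_pderiv 1 A xi d1 -> row_pderiv 2 A xi d2 ->
  has_grad A xi /\ grad A xi = col3 d0 d1 d2.
Proof.
move=> h0 h1 h2; split.
  by move=> i j; case: (ord3P i) => ->;
    [ case: (is_pderivP xid (h0 j)) | case: (is_pderivP xid (h1 j))
    | case: (is_pderivP xid (h2 j)) ].
apply/matrixP => i j; rewrite mxE; have [e0 e1 e2] := col3E d0 d1 d2 j.
case: (ord3P i) => ->; rewrite ?e0 ?e1 ?e2.
- by case: (is_pderivP xid (h0 j)).
- by case: (is_pderivP xid (h1 j)).
- by case: (is_pderivP xid (h2 j)).
Qed.

Variables (N : nat) (A0 A1 A2 : 'rV[R]_3 -> 'rV[R]_N).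
Let A y : 'M[R]_(3, N) := col3 (A0 y) (A1 y) (A2 y).

Let A0E j : (fun y => A y 0 j) = (fun y => A0 y 0 j).
Proof. by apply/funext => y; case: (col3E (A0 y) (A1 y) (A2 y) j). Qed.
Let A1E j : (fun y => A y 1 j) = (fun y => A1 y 0 j).
Proof. by apply/funext => y; case: (col3E (A0 y) (A1 y) (A2 y) j). Qed.
Let A2E j : (fun y => A y 2 j) = (fun y => A2 y 0 j).
Proof. by apply/funext => y; case: (col3E (A0 y) (A1 y) (A2 y) j). Qed.

Lemma curlP (d01 d02 d10 d12 d20 d21 : 'rV[R]_N) :
  row_pderiv 0 A1 xi d01 -> row_pderiv 0 A2 xi d02 ->
  row_pderiv 1 A0 xi d10 -> row_pderiv 1 A2 xi d12 ->
  row_pderiv 2 A0 xi d20 -> row_pderiv 2 A1 xi d21 ->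
  has_curl A xi /\ curl A xi = col3 (d12 - d21) (d20 - d02) (d01 - d10).
Proof.
move=> h01 h02 h10 h12 h20 h21; split.
  move=> i k j; case: (ord3P i) => ->; case: (ord3P k) => ->;
    rewrite ?eqxx// => _; rewrite ?A0E ?A1E ?A2E.
  - by case: (is_pderivP xid (h01 j)).
  - by case: (is_pderivP xid (h02 j)).
  - by case: (is_pderivP xid (h10 j)).
  - by case: (is_pderivP xid (h12 j)).
  - by case: (is_pderivP xid (h20 j)).
  - by case: (is_pderivP xid (h21 j)).
have s11 : 1 + 1 = 2 :> 'I_3 by exact: val_inj.
have s12 : 1 + 2 = 0 :> 'I_3 by exact: val_inj.
have s21 : 2 + 1 = 0 :> 'I_3 by exact: val_inj.
have s22 : 2 + 2 = 1 :> 'I_3 by exact: val_inj.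
apply/matrixP => i j; rewrite mxE.
have [e0 e1 e2] := col3E (d12 - d21) (d20 - d02) (d01 - d10) j.
case: (ord3P i) => ->; rewrite ?e0 ?e1 ?e2 ?add0r ?s11 ?s12 ?s21 ?s22
  ?A0E ?A1E ?A2E !mxE.
- have [_ ->] := is_pderivP xid (h12 j).
  by have [_ ->] := is_pderivP xid (h21 j).
- have [_ ->] := is_pderivP xid (h20 j).
  by have [_ ->] := is_pderivP xid (h02 j).
- have [_ ->] := is_pderivP xid (h01 j).
  by have [_ ->] := is_pderivP xid (h10 j).
Qed.

Lemma divergenceP (d0 d1 d2 : 'rV[R]_N) :
  row_pderiv 0 A0 xi d0 -> row_pderiv 1 A1 xi d1 -> row_pderiv 2 A2 xi d2 ->
  has_divergence A xi /\ divergence A xi = d0 + d1 + d2.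
Proof.
move=> h0 h1 h2; split.
  move=> i j; case: (ord3P i) => ->; rewrite ?A0E ?A1E ?A2E.
  - by case: (is_pderivP xid (h0 j)).
  - by case: (is_pderivP xid (h1 j)).
  - by case: (is_pderivP xid (h2 j)).
apply/rowP => j; rewrite !mxE !big_ord_recl big_ord0 addr0 addrA.
have -> : lift ord0 ord0 = 1 :> 'I_3 by exact: val_inj.
have -> : lift ord0 (lift ord0 ord0) = 2 :> 'I_3 by exact: val_inj.
rewrite A0E A1E A2E.
have [_ ->] := is_pderivP xid (h0 j); have [_ ->] := is_pderivP xid (h1 j).
by have [_ ->] := is_pderivP xid (h2 j).
Qed.
End Operators.

Theorem proposition3p2 (R : realType) (p n1 n2 n3 : nat)
    (hp : (1 <= p)%N) (hn1 : (1 <= n1)%N) (hn2 : (1 <= n2)%N)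
    (hn3 : (1 <= n3)%N) :
  [/\ curlM R p n1 n2 n3 *m gradM R p n1 n2 n3 = 0,
      divM R p n1 n2 n3 *m curlM R p n1 n2 n3 = 0
    & forall xi : 'rV[R]_3, xi_dom xi -> (p = 1%N -> off_knots n1 n2 n3 xi) ->
      [/\ has_grad (Lambda0 p n1 n2 n3) xi
          /\ grad (Lambda0 p n1 n2 n3) xi
             = Lambda1 p n1 n2 n3 xi *m gradM R p n1 n2 n3,
          has_curl (Lambda1 p n1 n2 n3) xi
          /\ curl (Lambda1 p n1 n2 n3) xi
             = Lambda2 p n1 n2 n3 xi *m curlM R p n1 n2 n3
        & has_divergence (Lambda2 p n1 n2 n3) xi
          /\ divergence (Lambda2 p n1 n2 n3) xi
             = Lambda3 p n1 n2 n3 xi *m divM R p n1 n2 n3]].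
Proof.
split; [exact: curlM_gradM|exact: divM_curlM|move=> xi xid off].
have dT0 := tens_pderiv1 hp hn1 xid off.
have dT1 := tens_pderiv2 hp hn2 xid off.
have dT2 := tens_pderiv3 hp hn3 xid off.
have Z i N := @row_pderiv0 R i N xi.
split.
- rewrite /Lambda1 /gradM col3row_mulmx !row3_mulmx_col3 !mul0mx !addr0 !add0r.
  exact: (gradP xid (dT0 _ _) (dT1 _ _) (dT2 _ _)).
- rewrite /Lambda2 /curlM col3row_mulmx !row3_mulmx_col3 !mul0mx !addr0 !add0r.
  rewrite !mulmx_row3 !mulmx0 !mulmxN.
  have := curlP xid
    (row_pderiv_row3 (Z _ _) (dT0 p.-1 p) (Z _ _))
    (row_pderiv_row3 (Z _ _) (Z _ _) (dT0 p p.-1))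
    (row_pderiv_row3 (dT1 p.-1 p) (Z _ _) (Z _ _))
    (row_pderiv_row3 (Z _ _) (Z _ _) (dT1 p p.-1))
    (row_pderiv_row3 (dT2 p.-1 p) (Z _ _) (Z _ _))
    (row_pderiv_row3 (Z _ _) (dT2 p p.-1) (Z _ _)).
  rewrite !opp_row3 !add_row3 !oppr0 !addr0 !add0r; exact.
- rewrite /Lambda3 /divM mulmx_row3.
  have := divergenceP xid
    (row_pderiv_row3 (dT0 p.-1 p.-1) (Z _ _) (Z _ _))
    (row_pderiv_row3 (Z _ _) (dT1 p.-1 p.-1) (Z _ _))
    (row_pderiv_row3 (Z _ _) (Z _ _) (dT2 p.-1 p.-1)).
  rewrite !add_row3 !addr0 !add0r; exact.
Qed.
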